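(* Let $p$ be a prime number, let $k$ be an $F$-finite field of characteristic $p$, and let $A:=k[x_1,\dots,x_d]$ be a polynomial ring equipped with a structure of $\mathbb{N}_{\ge 0}$-graded ring such that $x_i$ is a homogeneous element of positive degree $a_i>0$ for every $i$. Let $\mathfrak{m}:=(x_1,\dots,x_d)$ denote the homogeneous maximal ideal of $A$ and let $f\in\mathfrak{m}$ be a homogeneous polynomial of degree $D>0$. Assume the following two conditions. (a) $\mathrm{fpt}(A_{\mathfrak{m}};(f)) < \left(\sum_{i=1}^d a_i\right)/D$. (b) $\mathrm{fpt}(A_{\mathfrak{m}};(f))\notin \mathbb{Z}[1/p]$. Then $\mathrm{fpt}(A_{\mathfrak{m}};(f)) \in \mathrm{Accum}(\mathrm{FPT}^{\mathrm{pr}}(A_{\mathfrak{m}}))$.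
   Context: A ring of characteristic $p>0$ is $F$-finite if its Frobenius map is a finite ring homomorphism. $F^e_*B$ denotes a ring $B$ viewed as a $B$-module via the $e$-th iterate of Frobenius. The grading on $A=k[x_1,\dots,x_d]$ is the weighted grading in which elements of $k$ have degree $0$. For an $F$-finite regular local ring $B$ of characteristic $p$ and a non-zero principal ideal $(g)\subsetneq B$, the $F$-pure threshold $\mathrm{fpt}(B;(g))$ is the supremum of all real $s\ge 0$ for which there exist an integer $e>0$ and $\phi\in \mathrm{Hom}_B(F^e_*B,B)$ with $\phi(F^e_*(g^{\lceil s(p^e-1)\rceil}B))=B$. By convention $\mathrm{fpt}(B;(0))=0$. Here $\mathrm{fpt}(A_{\mathfrak m};(f))$ means the threshold of the ideal generated by $f$ in the localization $A_{\mathfrak m}$. $\mathrm{FPT}^{\mathrm{pr}}(B):=\{\mathrm{fpt}(B;\mathfrak{a}) \mid \mathfrak{a}\subsetneq B \text{ a principal ideal}\}\subseteq \mathbb{R}_{\ge 0}$. For $S\subseteq\mathbb{R}$, $\mathrm{Accum}(S)\subseteq \mathbb{R}$ is the set of all accumulation points of $S$, i.e. real numbers $t$ such that every neighbourhood of $t$ contains an element of $S$ different from $t$. *)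

(* Defs.v *)
From HB Require Import structures.
From mathcomp Require Import all_boot all_order all_algebra.
From mathcomp Require Import ring_quotient.
From mathcomp Require Import mpoly.
From mathcomp Require Import boolp classical_sets reals topology num_topology.

Set Implicit Arguments.
Unset Strict Implicit.
Unset Printing Implicit Defensive.

Import Order.TTheory GRing.Theory Num.Theory.
Import numFieldTopology.Exports.

Local Open Scope classical_set_scope.
Local Open Scope ring_scope.

(* F^e_* B: the additive group of B, on which b acts as multiplication by
   b ^+ (p ^ e). *)
Definition frobenius_push (B : comNzRingType) (p : nat) (chB : p \in [pchar B])
  (e : nat) : Type := B.

Section FrobeniusPush.
Variables (B : comNzRingType) (p : nat) (chB : p \in [pchar B]) (e : nat).
Local Notation FB := (frobenius_push chB e).
Local Notation phi := (pFrobenius_aut chB).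

HB.instance Definition _ := GRing.Zmodule.copy FB B.

Definition frobenius_scale (b : B) (x : FB) : FB := iter e phi b * (x : B).

Let iterM (b c : B) : iter e phi (b * c) = iter e phi b * iter e phi c.
Proof.
elim: e => //= n ->; rewrite pFrobenius_autM_comm //; exact: mulrC.
Qed.

Let iterD (b c : B) : iter e phi (b + c) = iter e phi b + iter e phi c.
Proof.
elim: e => //= n ->; rewrite pFrobenius_autD_comm //; exact: mulrC.
Qed.

Let iter1 : iter e phi 1 = 1.
Proof. by elim: e => //= n ->; rewrite pFrobenius_aut1. Qed.

Let scaleA (a b : B) (v : FB) :
  frobenius_scale a (frobenius_scale b v) = frobenius_scale (a * b) v.
Proof. by rewrite /frobenius_scale iterM mulrA. Qed.

Let scale1 : left_id 1 frobenius_scale.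
Proof. by move=> v; rewrite /frobenius_scale iter1 mul1r. Qed.

Let scaleDr : right_distributive frobenius_scale +%R.
Proof. by move=> a u v; rewrite /frobenius_scale mulrDr. Qed.

Let scaleDl (v : FB) : {morph frobenius_scale^~ v : a b / a + b}.
Proof. by move=> a b; rewrite /frobenius_scale iterD mulrDl. Qed.

HB.instance Definition _ :=
  GRing.Zmodule_isLmodule.Build B FB scaleA scale1 scaleDr scaleDl.
End FrobeniusPush.

(* Finiteness of the Frobenius of B, as finite generation of the B-module
   F_* B. *)
Definition F_finite (B : comNzRingType) (p : nat) (chB : p \in [pchar B]) : Prop :=
  exists (n : nat) (v : 'I_n -> frobenius_push chB 1),
    forall x : frobenius_push chB 1,
      exists c : 'I_n -> B, x = \sum_(i < n) c i *: v i.

Definition principal_ideal (B : comNzRingType) (g : B) : set B :=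
  [set x | exists b, x = g * b].

Section FPureThreshold.
Variables (R : realType) (B : comNzRingType) (p : nat) (chB : p \in [pchar B]).

Definition fpt_exponent (g : B) (s : R) : Prop :=
  exists e : nat, (0 < e)%N /\
  exists phi : {linear frobenius_push chB e -> B^o},
    phi @` (principal_ideal (g ^+ `|Num.ceil (s * (p ^ e - 1)%N%:R)|%N)) = setT.

(* [fpt g] is fpt(B; (g)).  For B F-finite regular local and (g) a non-zero
   proper ideal, the set below contains 0 and is bounded by 1, so [sup] is a
   genuine supremum. *)
Definition fpt (g : B) : R :=
  if g == 0 then 0 else sup [set s : R | 0 <= s /\ fpt_exponent g s].

Definition FPTpr : set R :=
  [set t | exists g : B, principal_ideal g <> setT /\ t = fpt g].
End FPureThreshold.

Arguments fpt R {B p} chB g.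
Arguments FPTpr R {B p} chB _.

Section Localization.
Variables (A : idomainType) (P : prime_idealr A).

(* The fractions a / s with s outside P: this is A_P as a subring of Frac A. *)
Definition loc_pred : pred {fraction A} := fun x =>
  `[< exists a s : A, s \notin P /\ x = FracField.tofrac a / FracField.tofrac s >].

Let frac_neq0 (s : A) : s \notin P -> FracField.tofrac s != 0.
Proof. by rewrite tofrac_eq0; apply: contraNneq => ->; apply: idealr0. Qed.

Let mulP (s t : A) : s \notin P -> t \notin P -> s * t \notin P.
Proof. by move=> sP tP; rewrite (@prime_idealrM _ P) negb_or sP. Qed.

Let oneP : 1 \notin P.
Proof. by rewrite idealr1. Qed.

Lemma loc_subring_closed : subring_closed loc_pred.
Proof.
split.
- apply/asboolP; exists 1, 1; split; first exact: oneP.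
  by rewrite tofrac1 divr1.
- move=> _ _ /asboolP[a [s [sP ->]]] /asboolP[b [t [tP ->]]].
  apply/asboolP; exists (a * t - b * s), (s * t); split; first exact: mulP.
  by rewrite -mulNr addf_div ?frac_neq0 // tofracB !tofracM mulNr.
- move=> _ _ /asboolP[a [s [sP ->]]] /asboolP[b [t [tP ->]]].
  apply/asboolP; exists (a * b), (s * t); split; first exact: mulP.
  by rewrite mulf_div !tofracM.
Qed.

HB.instance Definition _ :=
  GRing.isSubringClosed.Build {fraction A} loc_pred loc_subring_closed.

Record localization := Localization {
  loc_val :> {fraction A}; _ : loc_val \in loc_pred }.

HB.instance Definition _ := [isSub for loc_val].
HB.instance Definition _ := [Choice of localization by <:].
HB.instance Definition _ := [SubChoice_isSubComNzRing of localization by <:].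

Lemma loc_of_subproof (a : A) : FracField.tofrac a \in loc_pred.
Proof. by apply/asboolP; exists a, 1; split; rewrite ?oneP // tofrac1 divr1. Qed.

Definition loc_of (a : A) : localization := Localization (loc_of_subproof a).

Lemma loc_of_is_zmod_morphism : zmod_morphism loc_of.
Proof. by move=> a b; apply: val_inj; rewrite rmorphB /= tofracB. Qed.

Lemma loc_of_is_monoid_morphism : monoid_morphism loc_of.
Proof.
split; first by apply: val_inj; rewrite rmorph1 /= tofrac1.
by move=> a b; apply: val_inj; rewrite rmorphM /= tofracM.
Qed.

HB.instance Definition _ :=
  GRing.isZmodMorphism.Build A localization loc_of loc_of_is_zmod_morphism.
HB.instance Definition _ :=
  GRing.isMonoidMorphism.Build A localization loc_of loc_of_is_monoid_morphism.
End Localization.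

Section PolynomialRing.
Variables (k : fieldType) (d : nat).
Local Notation A := {mpoly k[d]}.

Definition mmax : pred A := fun f =>
  `[< exists c : 'I_d -> A, f = \sum_(i < d) c i * 'X_i >].

Let mmaxX (c : k) (m : 'X_{1..d}) : m != 0%MM -> c *: 'X_[m] \in mmax.
Proof.
move=> m0; have [i mi] : exists i, (0 < m i)%N.
  apply/existsP; apply: contraNT m0; rewrite negb_exists => /forallP h.
  by apply/eqP/mnmP => i; rewrite mnm0E; have := h i; rewrite lt0n negbK => /eqP.
apply/asboolP; exists (fun j => if j == i then c *: 'X_[m - U_(i)] else 0).
rewrite (bigD1 i) //= eqxx big1 ?addr0; last first.
  by move=> j /negbTE ->; rewrite mul0r.
by rewrite -scalerAl -mpolyXD submK // lep1mP -lt0n.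
Qed.

Lemma mmaxE (f : A) : (f \in mmax) = (f@_0%MM == 0).
Proof.
apply/asboolP/eqP => [[c ->]|f0].
  rewrite raddf_sum big1 //= => i _.
  by rewrite rmorphM /= mcoeffX mnm1_eq0 mulr0.
have : \sum_(m <- msupp f) f@_m *: 'X_[m] \in mmax.
  rewrite big_seq; elim/big_ind: _ => [|g h /asboolP[c ->] /asboolP[c' ->]|m].
  - apply/asboolP; exists (fun=> 0); rewrite big1 // => i _; exact: mul0r.
  - apply/asboolP; exists (fun i => c i + c' i).
    by rewrite -big_split; apply: eq_bigr => i _; rewrite mulrDl.
  - rewrite mcoeff_msupp => fm; apply: mmaxX.
    by apply: contraNneq fm => ->; rewrite f0.
by rewrite -mpolyE => /asboolP.
Qed.

Lemma mmax_idealr_closed : idealr_closed mmax.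
Proof.
split; rewrite ?mmaxE ?mcoeff0 ?mcoeff1 ?eqxx ?oner_eq0 //.
move=> a u v; rewrite !mmaxE rmorphD rmorphM /= => /eqP -> /eqP ->.
by rewrite mulr0 addr0.
Qed.

Lemma mmax_prime : prime_idealr_closed mmax.
Proof. by move=> u v; rewrite !mmaxE rmorphM /= mulf_eq0. Qed.

HB.instance Definition _ := isIdealr.Build A mmax mmax_idealr_closed.
HB.instance Definition _ := isPrimeIdealrClosed.Build A mmax mmax_prime.

(* The weighted degree with deg x_i = a i. *)
Definition wdeg (a : 'I_d -> nat) (m : 'X_{1..d}) : nat :=
  (\sum_(i < d) m i * a i)%N.

Lemma wdeg0 a : wdeg a 0%MM = 0%N.
Proof. by rewrite /wdeg big1 // => i _; rewrite mnm0E mul0n. Qed.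

Lemma wdegD a : {morph wdeg a : m1 m2 / (m1 + m2)%MM >-> (m1 + m2)%N}.
Proof.
move=> m1 m2; rewrite /wdeg -big_split; apply: eq_bigr => i _.
by rewrite mnmDE mulnDl.
Qed.

HB.instance Definition _ a := isMeasure.Build d (wdeg a) (wdeg0 a) (wdegD a).
End PolynomialRing.

Arguments mmax : clear implicits.

(* A_m for A = k[x_1, ..., x_d] and m = (x_1, ..., x_d). *)
Definition locA (k : fieldType) (d : nat) : comNzRingType :=
  localization (mmax k d).

Lemma locA_pchar (k : fieldType) (d p : nat) :
  p \in [pchar k] -> p \in [pchar locA k d].
Proof.
by move=> chk; apply: (rmorph_pchar (loc_of (mmax k d) \o @mpolyC d k)).
Qed.

(* Z[1/p], as a subset of R. *)
Definition Zinvp (R : realType) (p : nat) : set R :=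
  [set t | exists (z : int) (n : nat), t = z%:~R / p%:R ^+ n].

(* Main.v *)
Require Import Defs.
From HB Require Import structures.
From mathcomp Require Import all_boot all_order all_algebra.
From mathcomp Require Import ring_quotient.
From mathcomp Require Import mpoly.
From mathcomp Require Import boolp classical_sets reals topology num_topology.
From mathcomp Require Import ring lra.
Import Order.TTheory GRing.Theory Num.Theory.
Import numFieldTopology.Exports.
Local Open Scope classical_set_scope.
Local Open Scope ring_scope.

Set Implicit Arguments.
Unset Strict Implicit.
Unset Printing Implicit Defensive.

(** Write [q = p ^ e] and [m^[q] = (x_1^q, ..., x_d^q)].  The threshold is
    governed by the powers of [f] outside [m^[q]]: if [f^n] is not in [m^[q]]
    then [n / (q - 1) <= fpt f] ([fpt_ge]), and if [f^n] is in [m^[q]] then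
    [fpt f <= n / q] ([fpt_le]).  Let [c = fpt f] and [N_e = floor (c q)].
    As [c] is not in Z[1/p], these bounds say that [f^(N_e)] has a monomial
    [x^u] with all exponents below [q], while [f^(N_e + 1)] has none.

    Now perturb [f] to [g = f + x^w] with [u + w = (q - 1, ..., q - 1)].  The
    strict inequality [c < (sum a_i) / D] makes the degree of [x^w],
    which is [(q - 1) sum a_i - D N_e], tend to infinity with [e]; in
    particular it differs from [D], so that homogeneity of [f] isolates the
    term [(N_e + 1) f^(N_e) x^w] of [g^(N_e + 1)] as the only contribution in
    the degree of [x^(u + w)].  Hence [x^(q - 1, ..., q - 1)] occurs in
    [g^(N_e + 1)] as soon as [p] does not divide [N_e + 1], and then
    [fpt g >= (N_e + 1) / (q - 1) > c].  Such [e] are arbitrarily large,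
    because otherwise all late base-[p] digits of [c] would be [p - 1]
    ([exists_digit_neq]).  On the other hand, for a fixed [q' = p ^ e'] the
    monomial [x^w] lies in [m^[q']] once its degree is large, so that
    [g^(N_e' + 1)] is in [m^[q']] together with [f^(N_e' + 1)], and
    [fpt g <= (N_e' + 1) / q' <= c + 1 / q'].  So [c] is a limit from above.

    The link between the threshold and monomials is [splits_locP], a form of
    Fedder's criterion: some map in [Hom (F^e_* A_m, A_m)] sends a multiple of
    [a] to [1] exactly when [a] has a monomial with all exponents below [q].
    Maps are built in three stages: a retraction of the Frobenius
    of [k], obtained from a finite generating family; its extension to
    polynomials, acting coefficientwise on the monomials [x^(q v + u)]; and its
    extension to the localization by [a / s |-> phi (s^(q - 1) a) / s]. *)

(** * Maps in Hom (F^e_* B, B) *)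

(** The elements of [Hom (F^e_* B, B)] for [q = p ^ e], as maps of [B]: this
    form composes without any transport between the modules [F^e_* B]. *)
Definition cartier (B : comNzRingType) (q : nat) (phi : B -> B) : Prop :=
  {morph phi : x y / x + y} /\ forall c x, phi (c ^+ q * x) = c * phi x.

(** Surjectivity on the ideal [(x)] amounts to reaching [1], as the image of an
    ideal under a Cartier map is an ideal. *)
Definition splits (B : comNzRingType) (q : nat) (x : B) : Prop :=
  exists2 phi : B -> B, cartier q phi & exists b, phi (x * b) = 1.

Lemma cartier0 (B : comNzRingType) q (phi : B -> B) : cartier q phi -> phi 0 = 0.
Proof. by case=> phiD _; apply: (addrI (phi 0)); rewrite -phiD !addr0. Qed.

Section Splits.
Variable B : comNzRingType.
Implicit Types (q : nat) (x y : B).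

Lemma splits_divl q x y : splits q (x * y) -> splits q x.
Proof. by move=> [phi cphi [b bE]]; exists phi => //; exists (y * b); rewrite mulrA. Qed.

Lemma splits_exp_le q x m n : (m <= n)%N -> splits q (x ^+ n) -> splits q (x ^+ m).
Proof. by move=> /subnKC <-; rewrite exprD; apply: splits_divl. Qed.

Lemma splits_1 q : splits 1 (1 : B).
Proof. by exists id; [split=> // c x; rewrite expr1 | exists 1; rewrite mul1r]. Qed.

(** The composite of the two maps sends [y ^+ q * x * (b * c ^+ q)] to
    [y * c] and then to [1]. *)
Lemma splits_comp q Q x y :
  splits q x -> splits Q y -> splits (q * Q) (y ^+ q * x).
Proof.
move=> [phi [phiD phiZ] [b bE]] [psi [psiD psiZ] [c cE]].
exists (psi \o phi).
  by split=> [u v|c' u] /=; rewrite ?phiD ?psiD // mulnC exprM phiZ psiZ.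
exists (b * c ^+ q) => /=.
by rewrite mulrA -(mulrA _ x) mulrAC -exprMn phiZ bE mulr1.
Qed.

(** This passes from one exponent [e] to all its multiples without lowering the
    ratio [n / (q - 1)], which is what bounds thresholds from above. *)
Lemma splits_iter q n x r :
  splits q (x ^+ n) -> splits (q ^ r) (x ^+ (n * \sum_(i < r) q ^ i)).
Proof.
move=> sx; elim: r => [|r IHr].
  by rewrite big_ord0 muln0 expn0 expr0; apply: splits_1.
rewrite big_ord_recl expn0 mulnDr muln1 addnC exprD expnS.
have -> : (n * \sum_(i < r) q ^ bump 0 i = (n * \sum_(i < r) q ^ i) * q)%N.
  rewrite -mulnA big_distrl; congr muln.
  by apply: eq_bigr => i _; rewrite expnSr.
by rewrite exprM; apply: splits_comp.
Qed.

(** [phi (x ^+ q * b) = x * phi b] would make [x] a unit. *)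
Lemma nonunit_not_splits q x : (forall b, x * b <> 1) -> ~ splits q (x ^+ q).
Proof. by move=> nux [phi [_ phiZ] [b]]; rewrite phiZ; apply: nux. Qed.

End Splits.

Section CharP.
Variables (B : comNzRingType) (p : nat) (chB : p \in [pchar B]).

Lemma iter_pFrobenius e (b : B) : iter e (pFrobenius_aut chB) b = b ^+ (p ^ e).
Proof.
elim: e => [|e IHe]; first by rewrite expr1.
by rewrite iterS IHe pFrobenius_autE -exprM expnSr.
Qed.

Lemma exprD_pexp e (x y : B) : (x + y) ^+ (p ^ e) = x ^+ (p ^ e) + y ^+ (p ^ e).
Proof.
rewrite -!iter_pFrobenius; elim: e => //= e ->.
by apply: pFrobenius_autD_comm; apply: mulrC.
Qed.

(** Precompose with the [j]-th Frobenius: [y |-> phi (y ^+ (p ^ j) * b)] is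
    again a Cartier map, of lower exponent. *)
Lemma splits_root e j (x : B) :
  splits (p ^ (e + j)) (x ^+ (p ^ j)) -> splits (p ^ e) x.
Proof.
move=> [phi [phiD phiZ] [b bE]].
exists (fun y => phi (y ^+ (p ^ j) * b)); last by exists 1; rewrite mulr1.
split=> [u v|c u]; first by rewrite exprD_pexp mulrDl phiD.
by rewrite exprMn -exprM -mulrA -expnD phiZ.
Qed.

Lemma fpt_exponentP (R : realType) (g : B) (s : R) :
  fpt_exponent chB g s <->
  exists2 e, (0 < e)%N &
    splits (p ^ e) (g ^+ `|Num.ceil (s * (p ^ e - 1)%N%:R)|%N).
Proof.
split.
  case=> e [e0 [phi phiT]]; exists e => //.
  have := I : [set: B^o] 1; rewrite -[X in X 1]phiT => -[_ [b ->] phi1].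
  exists phi; last by exists b.
  split=> [x y|c x]; first exact: (raddfD phi).
  by have := linearZ_LR phi c x; rewrite /GRing.scale /= /frobenius_scale iter_pFrobenius.
move=> [e e0 [phi [phiD phiZ] [b bE]]].
exists e; split => //.
have phiN : zmod_morphism (phi : frobenius_push chB e -> B^o).
  move=> x y; apply: (addIr (phi y)); rewrite -phiD !subrK //.
have phil : scalable (phi : frobenius_push chB e -> B^o).
  by move=> c x; rewrite {1}/GRing.scale /= /frobenius_scale iter_pFrobenius phiZ.
pose P : {linear frobenius_push chB e -> B^o} :=
  HB.pack (phi : frobenius_push chB e -> B^o)
   (GRing.isZmodMorphism.Build (frobenius_push chB e) B^o phi phiN)
   (GRing.isScalable.Build B (frobenius_push chB e) B^o *:%R phi phil).
exists P; apply/seteqP; split=> // y _ /=.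
exists (g ^+ `|Num.ceil (s * (p ^ e - 1)%N%:R)| * (b * y ^+ (p ^ e))).
  by exists (b * y ^+ (p ^ e)).
by rewrite mulrA mulrC phiZ bE mulr1.
Qed.
End CharP.

(** * Bounds on the F-pure threshold *)

Section Threshold.
Variables (R : realType) (B : comNzRingType) (p : nat) (chB : p \in [pchar B]).
Variable g : B.

Let p_gt1 : (1 < p)%N.
Proof. exact: prime_gt1 (pcharf_prime chB). Qed.

(** Iterating the given splitting of exponent [e2] yields
    splittings of arbitrarily large exponent [E] for powers [m >= s (p^E - 1)],
    whereas [splits_root] forces [m < n p^(E - e)].  Letting [E] grow gives the
    bound; a single comparison at a fixed exponent would be off by the factor
    [p^e2 / (p^e2 - 1)]. *)
Lemma fpt_exponent_le e n (s : R) :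
  ~ splits (p ^ e) (g ^+ n) -> 0 <= s -> fpt_exponent chB g s ->
  s <= n%:R / (p ^ e)%:R.
Proof.
move=> Ngn s0 /fpt_exponentP[e2 e2_gt0]; set n2 := `|_|%N => sn2.
have n2E : s * (p ^ e2 - 1)%N%:R <= n2%:R.
  rewrite /n2 natr_absz ger0_norm; first exact: ceil_ge.
  by rewrite ceil_ge0; apply: lt_le_trans (mulr_ge0 s0 (ler0n _ _)); rewrite ltrN10.
rewrite leNgt; apply/negP => lt_s.
(* The second entry makes [p ^ E] exceed [s / (s - n / p ^ e)]. *)
pose r := maxn e (Num.truncn (s / (s - n%:R / (p ^ e)%:R))).+1.
have := splits_iter r sn2; set m := (n2 * _)%N; rewrite -expnM => sm.
have le_eE : (e <= e2 * r)%N.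
  by apply: leq_trans (leq_maxl _ _) _; apply: leq_pmull.
set E := (e2 * r)%N in sm le_eE.
have mE : s * (p ^ E - 1)%N%:R <= m%:R.
  rewrite subn1 /E expnM predn_exp -subn1 /m !natrM mulrA.
  exact: ler_wpM2r.
have le_m : (m <= n * p ^ (E - e))%N.
  rewrite leqNgt; apply/negP => /ltnW le_m; apply: Ngn.
  apply: (@splits_root _ _ chB e (E - e)); rewrite subnKC // -exprM.
  exact: splits_exp_le le_m sm.
have pe0 : 0 < (p ^ e)%:R :> R by rewrite ltr0n expn_gt0 ltnW.
have {}mE : s * ((p ^ E)%:R - 1) <= n%:R / (p ^ e)%:R * (p ^ E)%:R.
  rewrite -[X in _ - X]/(1%:R) -natrB ?expn_gt0 ?(ltnW p_gt1) //.
  apply: le_trans mE _; rewrite -(subnKC le_eE) expnD natrM mulrA divfK ?gt_eqF //.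
  by rewrite -natrM ler_nat.
have dpos : 0 < s - n%:R / (p ^ e)%:R by rewrite subr_gt0.
have : s < (p ^ E)%:R * (s - n%:R / (p ^ e)%:R).
  rewrite -ltr_pdivrMr //; apply: lt_le_trans (truncnS_gt _) _.
  rewrite ler_nat; apply: leq_trans (leq_maxr e _) _; rewrite -/r.
  apply: leq_trans (ltnW (ltn_expl _ p_gt1)).
  exact: leq_pmull.
rewrite mulrBr !(mulrC (p ^ E)%:R) ltrBrDr -ltrBrDl ltNge.
by move: mE; rewrite mulrBr mulr1 => ->.
Qed.

(** The set of exponents may be empty in a ring that is not F-split; its
    supremum is then [0]. *)
Lemma fpt_le e n :
  ~ splits (p ^ e) (g ^+ n) -> fpt R chB g <= n%:R / (p ^ e)%:R.
Proof.
move=> Ngn; have n_ge0 : 0 <= n%:R / (p ^ e)%:R :> R by rewrite divr_ge0.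
rewrite /fpt; case: eqP => [//|_].
have [->|] := eqVneq [set s : R | 0 <= s /\ fpt_exponent chB g s] set0.
  by rewrite sup0.
move=> /set0P S0; apply: ge_sup => // s [s0 gs].
exact: fpt_exponent_le Ngn s0 gs.
Qed.

(** The real number [n / (p ^ e - 1)] is itself an admissible exponent.  That
    [g] is not a unit bounds the set of exponents, by [1]. *)
Lemma fpt_ge e n :
  (forall b, g * b <> 1) -> (0 < e)%N -> splits (p ^ e) (g ^+ n) ->
  n%:R / (p ^ e - 1)%:R <= fpt R chB g.
Proof.
move=> gnu e_gt0 sgn; have q1 : (0 < p ^ e - 1)%N.
  by rewrite subn_gt0 -(expn0 p) ltn_exp2l.
rewrite /fpt; case: eqP => [g0|_].
  case: n sgn => [|n]; first by rewrite mul0r.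
  rewrite g0 expr0n => -[phi cphi [b]]; rewrite mul0r (cartier0 cphi) => /eqP.
  by rewrite eq_sym oner_eq0.
apply: ub_le_sup.
  exists 1 => s [s0 gs].
  have := @fpt_exponent_le 0 1 s _ s0 gs; rewrite divr1; apply.
  exact: nonunit_not_splits.
split; first by rewrite divr_ge0.
apply/fpt_exponentP; exists e => //.
by rewrite divfK ?pnatr_eq0 -?lt0n // pmulrn intrKceil absz_nat.
Qed.
End Threshold.

(** * Splitting the Frobenius of an F-finite field *)

Section FieldSplitting.
Variables (k : fieldType) (p : nat) (chk : p \in [pchar k]).

(** Among the sets of generators whose [k^p]-span [W] misses [1], take a maximal
    one.  By maximality every generator lies in [k^p + W], hence [k] is the
    direct sum of [k^p] and [W], and the projection to [k^p] followed by the
    [p]-th root is the required map. *)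
Lemma F_finite_splits : F_finite chk -> splits p (1 : k).
Proof.
case=> n [v vgen].
have expN (x : k) : (- x) ^+ p = - x ^+ p.
  by have := pFrobenius_autN chk x.
have expD (x y : k) : (x + y) ^+ p = x ^+ p + y ^+ p.
  by have := exprD_pexp chk 1 x y; rewrite expn1.
have exp0 : 0 ^+ p = 0 :> k.
  by rewrite expr0n gtn_eqF // prime_gt0 // (pcharf_prime chk).
pose W (S : {set 'I_n}) (x : k) :=
  exists c : 'I_n -> k, x = \sum_(i in S) c i ^+ p * (v i : k).
have WD S x y : W S x -> W S y -> W S (x + y).
  move=> [c ->] [c' ->]; exists (fun i => c i + c' i).
  by rewrite -big_split; apply: eq_bigr => i _; rewrite expD mulrDl.
have WZ S a x : W S x -> W S (a ^+ p * x).
  move=> [c ->]; exists (fun i => a * c i).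
  by rewrite mulr_sumr; apply: eq_bigr => i _; rewrite exprMn mulrA.
have WN S x : W S x -> W S (- x).
  by move=> /(WZ S (-1)); rewrite expN expr1n mulN1r.
have [S /maxsetP[/asboolP NS1 Smax] _] :
    {S | maxset (fun S => `[< ~ W S 1 >]) S & finset.set0 \subset S}.
  apply: maxset_exists; apply/asboolP => -[c]; rewrite big_set0 => /eqP.
  by rewrite oner_eq0.
have W0 : W S 0.
  exists (fun=> 0); rewrite big1 // => i _.
  by rewrite exp0 mul0r.
have Wv j : exists a, W S (v j - a ^+ p).
  have [jS|jS] := boolP (j \in S).
    exists 0; rewrite exp0 subr0.
    exists (fun i => (i == j)%:R); rewrite (bigD1 j) //= eqxx expr1n mul1r.
    rewrite big1 ?addr0 // => i /andP[_ /negbTE ->].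
    by rewrite exp0 mul0r.
  have [c cE] : W (j |: S) 1.
    apply: contrapT => NW; move/negP: jS; apply.
    rewrite -(Smax (j |: S)); first exact: finset.setU11.
      exact/asboolP.
    exact: finset.subsetUr.
  have c1E : c j ^+ p * v j - 1 = - \sum_(i in S) c i ^+ p * (v i : k).
    by rewrite cE big_setU1 //= opprD addrA subrr add0r.
  have cj : c j != 0.
    apply/eqP => cj0; apply: NS1; exists c; apply: oppr_inj.
    by rewrite -c1E cj0 exp0 mul0r sub0r.
  exists (c j)^-1; rewrite -[v j : k]mul1r -(expr1n _ p) -(mulVf cj) exprMn.
  rewrite -mulrA -[X in _ - X]mulr1 -mulrBr c1E.
  by apply: WZ; apply: WN; exists c.
have Wall x : exists a, W S (x - a ^+ p).
  have [c ->] := vgen x.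
  elim/big_ind: _ => [|y z [a Wa] [b Wb]|i _].
  - by exists 0; rewrite exp0 subr0.
  - by exists (a + b); rewrite expD opprD addrACA; apply: WD.
  - have [a Wa] := Wv i; exists (c i * a).
    by rewrite exprMn -mulrBr; apply: WZ.
have Wuniq x a b : W S (x - a ^+ p) -> W S (x - b ^+ p) -> a = b.
  move=> Wa /WN Wb; apply/eqP; rewrite -subr_eq0; apply: contrapT => /negP ab.
  apply: NS1; rewrite -(expr1n _ p) -(mulVf ab) exprMn; apply: WZ.
  rewrite expD expN; have := WN _ _ (WD _ _ _ Wa Wb).
  by rewrite opprB opprB addrC addrA subrK.
pose chi x := projT1 (cid (Wall x)).
have chiP x : W S (x - chi x ^+ p) := projT2 (cid (Wall x)).
exists chi.
  split=> [x y|c x].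
    apply: (Wuniq _ _ _ (chiP _)).
    by rewrite expD opprD addrACA; apply: WD.
  by apply: (Wuniq _ _ _ (chiP _)); rewrite exprMn -mulrBr; apply: WZ.
exists 1; apply: (Wuniq _ _ _ (chiP _)).
by rewrite expr1n mulr1 subrr.
Qed.

(** Splittings of [1] iterate, and a nonzero element of a field divides [1]. *)
Lemma F_finite_field_splits e (a : k) :
  F_finite chk -> a != 0 -> splits (p ^ e) a.
Proof.
move=> /F_finite_splits s1 a0; apply: (@splits_divl _ _ _ a^-1).
rewrite mulfV //; have := @splits_iter k p 1 1 e; rewrite !expr1n; exact.
Qed.
End FieldSplitting.

(** * Extension to a localization *)

Section LocalizationExtension.
Variables (A : idomainType) (P : prime_idealr A).
Local Notation tofrac := (@FracField.tofrac A).
Local Notation B := (localization P).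

Let tofrac_neq0 (s : A) : s \notin P -> tofrac s != 0.
Proof. by rewrite tofrac_eq0; apply: contraNneq => ->; apply: idealr0. Qed.

Let notinM (s t : A) : s \notin P -> t \notin P -> s * t \notin P.
Proof. by move=> sP tP; rewrite (@prime_idealrM _ P) negb_or sP. Qed.

Let notin1 : 1 \notin P.
Proof. by rewrite idealr1. Qed.

Let notinX (s : A) n : s \notin P -> s ^+ n \notin P.
Proof.
by move=> sP; elim: n => [|n IHn]; rewrite ?expr0 ?notin1 // exprS notinM.
Qed.

Let locP (x : B) : exists a s : A, s \notin P /\ val x = tofrac a / tofrac s.
Proof. exact/asboolP/(valP x). Qed.

Let loc_common (x y : B) : exists a b s : A, [/\ s \notin P,
  val x = tofrac a / tofrac s & val y = tofrac b / tofrac s].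
Proof.
have [a [s [sP xE]]] := locP x; have [b [t [tP yE]]] := locP y.
exists (a * t), (b * s), (s * t); split; first exact: notinM.
  by rewrite xE !tofracM -mulf_div divff ?mulr1 ?tofrac_neq0.
by rewrite yE !tofracM [tofrac s * tofrac t]mulrC -mulf_div divff ?mulr1 ?tofrac_neq0.
Qed.

Lemma loc_of_unit (s : A) : s \notin P -> exists y : B, loc_of P s * y = 1.
Proof.
move=> sP; have vP : 1 / tofrac s \in loc_pred P.
  by apply/asboolP; exists 1, s; rewrite tofrac1.
exists (Localization vP); apply: val_inj.
by rewrite rmorphM rmorph1 /= mul1r divff // tofrac_neq0.
Qed.

(** The fractions with numerator in [P] form a proper ideal. *)
Lemma loc_sum_neq1 n (a : 'I_n -> A) (y : 'I_n -> B) :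
  (forall i, a i \in P) -> \sum_(i < n) loc_of P (a i) * y i <> 1.
Proof.
move=> aP sum1.
pose J (x : B) := exists b s : A,
  [/\ b \in P, s \notin P & val x = tofrac b / tofrac s].
have : J (\sum_(i < n) loc_of P (a i) * y i).
  elim/big_ind: _ => [|x x' [b [s [bP sP xE]]] [c [t [cP tP yE]]]|i _].
  - by exists 0, 1; split; rewrite ?notin1 ?idealr0 // rmorph0 tofrac0 mul0r.
  - exists (t * b + s * c), (s * t); split; last first.
    + by rewrite rmorphD /= xE yE addf_div ?tofrac_neq0 // tofracD !tofracM
        (mulrC (tofrac t)) (mulrC (tofrac s) (tofrac c)).
    + exact: notinM.
    + by rewrite rpredD // idealMr.
  - have [c [s [sP yE]]] := locP (y i); exists (c * a i), s; split => //.
      exact: idealMr.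
    by rewrite rmorphM /= yE tofracM mulrA (mulrC (tofrac c)).
rewrite sum1 => -[b [s [bP sP]]]; rewrite rmorph1 => /(congr1 ( *%R^~ (tofrac s))).
rewrite divfK ?tofrac_neq0 // mul1r => /eqP; rewrite tofrac_eq => /eqP sb.
by rewrite sb bP in sP.
Qed.

(** A Cartier map must send [a / s = s^(q - 1) a / s^q] to
    [T (s^(q - 1) a) / s]; cross-multiplication shows that this does not depend
    on the fraction chosen. *)
Lemma cartier_loc q (T : A -> A) : (0 < q)%N -> cartier q T ->
  exists2 Phi : B -> B, cartier q Phi &
    forall a, Phi (loc_of P a) = loc_of P (T a).
Proof.
move=> q_gt0 [TD TZ].
have qE : q = q.-1.+1 by rewrite prednK.
have ex (x : B) : exists y : B, forall a s, s \notin P ->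
    val x = tofrac a / tofrac s -> val y = tofrac (T (s ^+ q.-1 * a)) / tofrac s.
  have [a [s [sP xE]]] := locP x.
  have vP : tofrac (T (s ^+ q.-1 * a)) / tofrac s \in loc_pred P.
    by apply/asboolP; exists (T (s ^+ q.-1 * a)), s.
  exists (Localization vP) => b t tP; rewrite xE => /eqP.
  rewrite eqr_div ?tofrac_neq0 // -!tofracM tofrac_eq => /eqP ab /=.
  apply/eqP; rewrite eqr_div ?tofrac_neq0 // -!tofracM tofrac_eq; apply/eqP.
  rewrite mulrC -TZ [RHS]mulrC -TZ; congr T; rewrite {1 3}qE !exprS.
  move: (s ^+ _) (t ^+ _) => u v.
  have -> : t * v * (u * a) = u * v * (a * t) by ring.
  by rewrite ab; ring.
pose Phi x := projT1 (cid (ex x)).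
have PhiE (x : B) a s : s \notin P -> val x = tofrac a / tofrac s ->
  val (Phi x) = tofrac (T (s ^+ q.-1 * a)) / tofrac s := projT2 (cid (ex x)) a s.
exists Phi; last first.
  move=> a; apply: val_inj; rewrite (PhiE _ a 1) ?notin1 //=.
    by rewrite expr1n mul1r tofrac1 divr1.
  by rewrite tofrac1 divr1.
split=> [x y|c x].
  have [a [b [s [sP xE yE]]]] := loc_common x y.
  apply: val_inj; rewrite rmorphD /= (PhiE _ _ _ sP xE) (PhiE _ _ _ sP yE).
  rewrite (PhiE _ (a + b) s) ?mulrDr ?TD ?tofracD ?mulrDl //.
  by rewrite rmorphD /= xE yE.
have [b [a [s [sP cE xE]]]] := loc_common c x.
apply: val_inj; rewrite rmorphM /= cE (PhiE _ _ _ sP xE).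
rewrite (PhiE _ (b ^+ q * a) (s ^+ q * s)) ?notinM ?notinX //; last first.
  by rewrite rmorphM rmorphXn /= cE xE !tofracM !tofracXn expr_div_n mulf_div.
have -> : (s ^+ q * s) ^+ q.-1 * (b ^+ q * a)
    = (s ^+ q.-1 * b) ^+ q * (s ^+ q.-1 * a).
  by rewrite !exprMn -!exprM (mulnC q) -!mulrA; congr (_ * _); rewrite mulrCA.
have := tofrac_neq0 (notinX q.-1 sP).
have -> : s ^+ q = s * s ^+ q.-1 by rewrite -exprS -qE.
rewrite TZ; move: (s ^+ q.-1) (T _) => u w u0.
by rewrite !tofracM mulf_div -[RHS]mul1r -(divff u0) mulf_div !mulrA (mulrC (tofrac s)).
Qed.
End LocalizationExtension.

(** * Polynomials and Fedder's criterion *)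

Section PolynomialTrace.
Variables (k : fieldType) (p : nat) (chk : p \in [pchar k]) (d : nat).
Implicit Types (m u v : 'X_{1..d}) (a b : {mpoly k[d]}).

Lemma mcoeffMX_nle a m v : ~~ (m <= v)%MM -> (a * 'X_[m])@_v = 0.
Proof.
move=> Nmv; apply: memN_msupp_eq0; apply: contra Nmv.
rewrite (perm_mem (msuppMX _ _)) => /mapP[w _ ->].
by apply/mnm_lepP => i; rewrite mnmDE leq_addr.
Qed.

(** The monomials [x^u] with exponents below [q] form a basis of [A] over
    [k[x_1^q, ..., x_d^q]]; [T] is the coordinate along one of them, combined
    with [chi] on the coefficients. *)
Lemma cartier_mpoly e (chi : k -> k) u :
  cartier (p ^ e) chi -> (forall i, (u i < p ^ e)%N) ->
  exists2 T : {mpoly k[d]} -> {mpoly k[d]}, cartier (p ^ e) T &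
    forall a v, (T a)@_v = chi a@_(v *+ (p ^ e) + u).
Proof.
move=> cchi ltu; have [chiD chiZ] := cchi; have chi0 := cartier0 cchi.
have chP : p \in [pchar {mpoly k[d]}] := rmorph_pchar (@mpolyC d k) chk.
set q := (p ^ e)%N in cchi ltu chiZ *.
have q_gt0 : (0 < q)%N by rewrite expn_gt0 prime_gt0 // (pcharf_prime chk).
pose T a : {mpoly k[d]} :=
  \sum_(v : 'X_{1..d < msize a}) chi a@_(v *+ q + u) *: 'X_[v].
have TE a v : (T a)@_v = chi a@_(v *+ q + u).
  have [lt_va|le_av] := ltnP (mdeg v) (msize a).
    exact: (mcoeff_mpoly (fun v => chi a@_(v *+ q + u))).
  rewrite [a@_ _]memN_msupp_eq0 ?chi0; last first.
    apply: msize_mdeg_ge; apply: leq_trans le_av _.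
    by rewrite mdegD mdegMn -[leqLHS]addn0 leq_add // leq_pmulr.
  rewrite raddf_sum big1 //= => w _; rewrite mcoeffZ mcoeffX.
  case: eqP => [wv|]; last by rewrite mulr0.
  by move: (bmdeg w); rewrite wv ltnNge le_av.
exists T => //.
have TD : {morph T : a b / a + b}.
  by move=> a b; apply/mpolyP => v; rewrite mcoeffD !TE mcoeffD chiD.
(* If [m <= v] fails then so does [m *+ q <= v *+ q + u], since [u < q]. *)
have TX m a : T ('X_[m] ^+ q * a) = 'X_[m] * T a.
  apply/mpolyP => v; rewrite TE mpolyXn [_ * a]mulrC ['X_[m] * _]mulrC.
  have [le_mv|Nle_mv] := boolP (m <= v)%MM.
    rewrite -(submK le_mv) [(_ - m + m)%MM]addmC mcoeffMX TE.
    rewrite (_ : ((m + (v - m)) *+ q + u)%MM = (m *+ q + ((v - m) *+ q + u))%MM).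
      by rewrite mcoeffMX.
    by apply/mnmP => i; rewrite !(mnmDE, mulmnE) mulnDl addnA.
  rewrite !mcoeffMX_nle // ?chi0 //; apply: contra Nle_mv => /mnm_lepP le_mv.
  apply/mnm_lepP => i; have := le_mv i; rewrite mnmDE !mulmnE -ltnS => lt_mv.
  rewrite -ltnS -(ltn_pmul2r q_gt0) mulSn addnC.
  by apply: leq_trans lt_mv _; rewrite ltn_add2l.
split=> // c a; elim/mpolyind: c => [|c m b _ _ IHb].
  by rewrite expr0n gtn_eqF // !mul0r; apply/mpolyP => v; rewrite TE !mcoeff0.
rewrite (exprD_pexp chP) mulrDl TD IHb [RHS]mulrDl; congr (_ + _).
rewrite exprZn -!scalerAl -TX; apply/mpolyP => v.
by rewrite !(mcoeffZ, TE) chiZ.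
Qed.

(** Membership in [m^[q]] is tested on monomials, as [m^[q]] is generated by
    monomials. *)
Lemma small_mcoeff0_frobenius_power q a : 
  (forall u, (forall i, (u i < q)%N) -> a@_u = 0) ->
  exists c : 'I_d -> {mpoly k[d]}, a = \sum_(i < d) 'X_i ^+ q * c i.
Proof.
move=> a0; rewrite [a]mpolyE big_seq.
elim/big_ind: _ => [|_ _ [c ->] [c' ->]|m].
- by exists (fun=> 0); rewrite big1 // => i _; rewrite mulr0.
- exists (fun i => c i + c' i).
  by rewrite -big_split; apply: eq_bigr => i _; rewrite mulrDr.
rewrite mcoeff_msupp => am.
have [i le_qm] : exists i, (q <= m i)%N.
  apply/existsP; apply: contraNT am; rewrite negb_exists => /forallP h.
  by apply/eqP/a0 => i; rewrite ltnNge.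
exists (fun j => if j == i then a@_m *: 'X_[m - U_(i) *+ q] else 0).
rewrite (bigD1 i) //= eqxx big1 ?addr0; last first.
  by move=> j /negbTE ->; rewrite mulr0.
rewrite -scalerAr mpolyXn -mpolyXD [in RHS]addmC submK //.
apply/mnm_lepP => j; rewrite mulmnE mnm1E.
by case: eqP => [<-|]; rewrite ?mul1n ?mul0n.
Qed.

(** Fedder's criterion for the regular local ring [A_m].  If every monomial of
    [a] lies in [m^[q]], a Cartier map sends the multiples of [a] into the
    maximal ideal.  Conversely, choose [chi] that hits [1] on the coefficient of
    [x^u]; the resulting map sends a multiple of [a] to a polynomial with
    constant term [1], a unit of [A_m]. *)
Lemma splits_locP e (Fk : F_finite chk) a :
  splits (p ^ e) (loc_of (mmax k d) a : locA k d) <->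
  exists2 u : 'X_{1..d}, (forall i, (u i < p ^ e)%N) & a@_u != 0.
Proof.
set q := (p ^ e)%N.
split=> [[phi cphi [b phib]]|[u ltu au]].
  apply: contrapT => Nu.
  have [c aE] : exists c : 'I_d -> {mpoly k[d]}, a = \sum_(i < d) 'X_i ^+ q * c i.
    apply: (@small_mcoeff0_frobenius_power q) => u ltu; apply/eqP.
    by apply: contrapT => /negP au; apply: Nu; exists u.
  have phi0 := cartier0 cphi; have [phiD phiZ] := cphi.
  apply: (@loc_sum_neq1 _ (mmax k d) d (fun i => 'X_i)
    (fun i => phi (loc_of (mmax k d) (c i) * b))).
    by move=> i; rewrite mmaxE mcoeffX mnm1_eq0.
  rewrite -phib aE raddf_sum mulr_suml (big_morph phi phiD phi0).
  apply: eq_bigr => i _ /=.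
  by rewrite rmorphM rmorphXn -mulrA phiZ.
have q_gt0 : (0 < q)%N by rewrite expn_gt0 prime_gt0 // (pcharf_prime chk).
have [chi [chiD chiZ] [b chib]] := F_finite_field_splits e Fk au.
have cchi : cartier q (fun x => chi (x * b)).
  by split=> [x y|c x]; rewrite ?mulrDl ?chiD // -mulrA chiZ.
have [T cT TE] := cartier_mpoly cchi ltu.
have [Phi cPhi PhiE] := cartier_loc (mmax k d) q_gt0 cT.
have [y yE] : exists y, loc_of (mmax k d) (T a) * y = 1.
  apply: loc_of_unit; rewrite mmaxE TE.
  have -> : (0 *+ (p ^ e) + u)%MM = u.
    by apply/mnmP => i; rewrite mnmDE mulmnE mnm0E mul0n.
  by rewrite chib oner_eq0.
exists Phi => //; exists (y ^+ q).
by rewrite mulrC (proj2 cPhi) PhiE mulrC.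
Qed.
End PolynomialTrace.

(** * Perturbation by a monomial *)

Lemma limit_point_above (R : realType) (E : set R) (c : R) :
  (forall eps, 0 < eps -> exists2 y, E y & c < y < c + eps) -> limit_point E c.
Proof.
move=> near_c U /nbhs_ballP[eps /= eps_gt0 epsU].
have [y Ey /andP[lt_cy lt_yc]] := near_c eps eps_gt0.
exists y; split=> //; first by rewrite gt_eqF.
apply: epsU; change (`|c - y| < eps).
by rewrite distrC gtr0_norm ?subr_gt0 // ltrBlDl.
Qed.

(** With [N_e = floor (c p^e)], the gap [N_e + 1 - c p^e] lies in [(0, 1]].  If
    [p] divided [N_e + 1] from some point on, then [N_(e+1) + 1 = p (N_e + 1)]
    and the gap would be multiplied by [p] at each step. *)
Lemma exists_digit_neq (R : realType) (p : nat) (c : R) (e0 : nat) :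
  (1 < p)%N -> 0 <= c ->
  exists2 e, (e0 <= e)%N & ~~ (p %| (Num.truncn (c * (p ^ e)%:R)).+1)%N.
Proof.
move=> p_gt1 c0; apply: contrapT => allp.
have dvd e : (e0 <= e)%N -> (p %| (Num.truncn (c * (p ^ e)%:R)).+1)%N.
  by move=> le_e; apply: contrapT => /negP Ndvd; apply: allp; exists e.
pose N j := Num.truncn (c * (p ^ (e0 + j))%:R).
have cN j : (N j)%:R <= c * (p ^ (e0 + j))%:R < (N j).+1%:R.
  by apply: truncn_itv; rewrite mulr_ge0.
have NS j : ((N j.+1).+1 = (N j).+1 * p)%N.
  have /andP[_ ltN] := cN j; have /andP[leN' ltN'] := cN j.+1.
  have pE : (p ^ (e0 + j.+1))%:R = (p ^ (e0 + j))%:R * p%:R :> R.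
    by rewrite addnS expnSr natrM.
  have p0 : 0 < p%:R :> R by rewrite ltr0n ltnW.
  apply/eqP; rewrite eqn_leq; apply/andP; split.
    have : (N j.+1)%:R < ((N j).+1 * p)%N%:R :> R.
      by apply: le_lt_trans leN' _; rewrite pE mulrA natrM ltr_pM2r.
    by rewrite ltr_nat.
  have /dvdnP[t tE] := dvd (e0 + j.+1)%N (leq_addr _ _).
  rewrite -/(N j.+1) in tE; rewrite tE leq_mul2r; apply/orP; right.
  rewrite ltnNge; apply/negP => le_t.
  have : c * (p ^ (e0 + j.+1))%:R < c * (p ^ (e0 + j.+1))%:R.
    apply: lt_le_trans ltN' _; rewrite tE pE mulrA natrM ler_pM2r //.
    by have /andP[leN _] := cN j; apply: le_trans leN; rewrite ler_nat.
  by rewrite ltxx.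
have NE j : ((N j).+1 = (N 0).+1 * p ^ j)%N.
  by elim: j => [|j IHj]; rewrite ?muln1 // NS IHj expnSr mulnA.
pose r := (N 0)%N.+1%:R - c * (p ^ e0)%:R.
have r_gt0 : 0 < r by have /andP[_] := cN 0; rewrite addn0 subr_gt0.
pose j := (Num.truncn r^-1).+1.
have : (p ^ j)%:R * r <= 1.
  have /andP[leN _] := cN j; move: leN; rewrite -(lerD2r 1) natr1 NE.
  rewrite natrM expnD natrM mulrA => H; rewrite mulrC mulrBl.
  by rewrite lerBlDl.
apply/negP; rewrite -ltNge -ltr_pdivrMr // mul1r.
apply: lt_trans (truncnS_gt _) _; rewrite ltr_nat.
exact: ltn_expl.
Qed.

Section Perturbation.
Variables (k : fieldType) (d : nat) (a : 'I_d -> nat) (D : nat).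
Variable f : {mpoly k[d]}.
Implicit Types u w : 'X_{1..d}.

Lemma mcoeff_perturbed_small q w i n u :
  (q <= w i)%N -> (u i < q)%N -> ((f + 'X_[w]) ^+ n)@_u = (f ^+ n)@_u.
Proof.
move=> le_qw lt_uq; apply/eqP; rewrite -subr_eq0 -mcoeffB subrXX.
rewrite [_ - f]addrC addKr mulrC mcoeffMX_nle //.
by apply/negP => /mnm_lepP/(_ i); apply/negP; rewrite -ltnNge (leq_trans lt_uq).
Qed.

(** The summand [f^(N + 1 - i) x^(i w)] is homogeneous of degree
    [D (N + 1 - i) + i deg w], which equals the degree [D N + deg w] of
    [x^(u + w)] only for [i = 1] when [deg w] differs from [D]. *)
Lemma mcoeff_perturbed_top N u w : f \is D.-homog for (wdeg a) ->
  (f ^+ N)@_u != 0 -> wdeg a w != D ->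
  ((f + 'X_[w]) ^+ N.+1)@_(u + w) = (f ^+ N)@_u *+ N.+1.
Proof.
move=> fD fu wD; have fXD n := dhomogMn n fD.
have uD : wdeg a u = (D * N)%N.
  by have /dhomogP := fXD N; apply; rewrite mcoeff_msupp.
rewrite exprDn raddf_sum (bigD1 (lift ord0 ord0)) //= big1 ?addr0.
  by rewrite mcoeffMn subSS subn0 expr1 addmC mcoeffMX bin1.
move=> [i ltiN] /= /eqP i1; rewrite mcoeffMn.
have homi : f ^+ (N.+1 - i) * 'X_[w] ^+ i
    \is (D * (N.+1 - i) + wdeg a w * i).-homog for (wdeg a).
  by apply: dhomogM => //; apply: dhomogMn; rewrite dhomogX.
rewrite (dhomog_nemf_coeff homi) ?mul0rn // mfD /= uD.
apply: contra wD => /eqP degE; apply/eqP.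
case: i {homi} => [|[|i]] in ltiN i1 degE *.
- by move: degE; rewrite muln0 addn0 subn0 mulnSr => /eqP; rewrite eqn_add2l => /eqP.
- by case: i1; apply: val_inj.
move: degE; rewrite subSS -{1}(subnK (_ : i.+1 <= N)%N) // mulnDr (mulnS _ i.+1) -addnA.
move=> /addnI. rewrite (addnC (D * _)%N) => /addnI /eqP.
by rewrite eqn_pmul2r // => /eqP.
Qed.
End Perturbation.

(** * The accumulation point *)

Section Main.
Variables (R : realType) (p : nat) (k : fieldType) (chk : p \in [pchar k]).
Variables (Fk : F_finite chk) (d : nat).
Local Notation loc := (loc_of (mmax k d)).
Local Notation fpt_loc g := (fpt R (locA_pchar d chk) (loc g)).
Implicit Types (f g : {mpoly k[d]}).

Lemma loc_of_mmax_nonunit f b : f \in mmax k d -> (loc f : locA k d) * b <> 1.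
Proof.
move=> fm; have := @loc_sum_neq1 _ (mmax k d) 1 (fun=> f) (fun=> b) (fun=> fm).
by rewrite big_ord1.
Qed.

Lemma mcoeff_small_fpt_ge f e n (u : 'X_{1..d}) : f \in mmax k d -> (0 < e)%N ->
  (forall i, (u i < p ^ e)%N) -> (f ^+ n)@_u != 0 ->
  n%:R / (p ^ e - 1)%:R <= fpt_loc f.
Proof.
move=> fm e_gt0 ltu fu; apply: fpt_ge => // [b|]; first exact: loc_of_mmax_nonunit.
by rewrite -rmorphXn; apply/(splits_locP _ Fk); exists u.
Qed.

Lemma mcoeff_small_fpt_le f e n :
  (forall u : 'X_{1..d}, (forall i, (u i < p ^ e)%N) -> (f ^+ n)@_u = 0) ->
  fpt_loc f <= n%:R / (p ^ e)%:R.
Proof.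
move=> f0; apply: fpt_le.
by rewrite -rmorphXn => /(splits_locP _ Fk)[u ltu]; rewrite f0 ?eqxx.
Qed.

End Main.

Theorem proposition3p1 (R : realType) (p : nat) (k : fieldType)
    (chk : p \in [pchar k]) (Fk : F_finite chk)
    (d : nat) (a : 'I_d -> nat) (ha : forall i, (0 < a i)%N)
    (D : nat) (hD : (0 < D)%N)
    (f : {mpoly k[d]}) (fm : f \in mmax k d) (fD : f \is D.-homog for (wdeg a)) :
  let c : R := fpt R (locA_pchar d chk) (loc_of (mmax k d) f) in
  c < (\sum_(i < d) a i)%N%:R / D%:R ->
  ~ Zinvp p c ->
  limit_point (FPTpr R (locA_pchar d chk)) c.
Proof.
move=> c c_lt cZ.
have p_gt1 : (1 < p)%N := prime_gt1 (pcharf_prime chk).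
have q_gt0 e : (0 < p ^ e)%N by rewrite expn_gt0 ltnW.
have qR_gt0 e : 0 < (p ^ e)%:R :> R by rewrite ltr0n.
have c_ge0 : 0 <= c.
  rewrite -[0](mul0r (p ^ 1 - 1)%:R^-1).
  apply: (@mcoeff_small_fpt_ge _ _ _ _ Fk _ _ _ 0 0%MM) => // [i|].
    by rewrite mnm0E.
  by rewrite expr0 mcoeff1 eqxx oner_eq0.
pose N e := Num.truncn (c * (p ^ e)%:R).
have cN e : (N e)%:R <= c * (p ^ e)%:R < (N e).+1%:R.
  by apply: truncn_itv; rewrite mulr_ge0.
have fN e : exists2 u : 'X_{1..d}, (forall i, (u i < p ^ e)%N) & (f ^+ N e)@_u != 0.
  apply: contrapT => Nu; apply: cZ; exists (Posz (N e)), e.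
  apply/eqP; rewrite -natrX -pmulrn eq_le ler_pdivrMr //.
  have /andP[-> _] := cN e; rewrite andbT; apply: mcoeff_small_fpt_le => // u ltu.
  by apply/eqP; apply: contrapT => /negP fu; apply: Nu; exists u.
have fNS e : (0 < e)%N -> forall u : 'X_{1..d}, (forall i, (u i < p ^ e)%N) ->
    (f ^+ (N e).+1)@_u = 0.
  move=> e_gt0 u ltu; apply/eqP; apply: contrapT => /negP fu.
  have := mcoeff_small_fpt_ge R Fk fm e_gt0 ltu fu; rewrite -/c.
  have q1_gt0 : (0 < p ^ e - 1)%N by rewrite subn_gt0 -(expn0 p) ltn_exp2l.
  rewrite ler_pdivrMr ?ltr0n // => le_Nc.
  have /andP[_] := cN e; rewrite ltNge => /negP; apply; apply: le_trans le_Nc _.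
  by rewrite ler_wpM2l // ler_nat leq_subr.
clearbody c.
apply: limit_point_above => eps eps_gt0.
pose e' := (Num.truncn eps^-1).+1.
pose q' := (p ^ e')%N.
have q'_eps : q'%:R^-1 < eps.
  rewrite invf_plt ?posrE ?qR_gt0 //; apply: lt_trans (truncnS_gt _) _.
  by rewrite ltr_nat ltn_expl.
pose s := (\sum_(i < d) a i)%N.
have gap : 0 < s%:R - D%:R * c.
  by rewrite subr_gt0 mulrC -ltr_pdivlMr // ltr0n.
(* A degree above [D + q' * s] exceeds [D] and puts [x^w] in [m^[q']]. *)
pose K := (D + q' * s)%N.
pose e1 := (Num.truncn ((s + K)%:R / (s%:R - D%:R * c))).+1.
have [e le_e pN] := exists_digit_neq e1 p_gt1 c_ge0.
have e_gt0 : (0 < e)%N by apply: leq_trans le_e.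
have qbig : (s + K)%:R < (p ^ e)%:R * (s%:R - D%:R * c).
  rewrite -ltr_pdivrMr //; apply: lt_trans (truncnS_gt _) _.
  by rewrite ltr_nat; apply: leq_ltn_trans le_e (ltn_expl _ p_gt1).
(* [x^w] completes the monomial [x^u] of [f^(N_e)] to the last monomial
   outside [m^[q]]. *)
have [u ltu fu] := fN e.
pose w : 'X_{1..d} := [multinom (p ^ e - 1 - u i)%N | i < d].
have uwE i : (u + w)%MM i = (p ^ e - 1)%N.
  by rewrite mnmDE mnmE subnKC // subn1 -ltnS prednK.
have uD : wdeg a u = (D * N e)%N.
  by have /dhomogP := dhomogMn (N e) fD; apply; rewrite mcoeff_msupp.
have wD : (K < wdeg a w)%N.
  have : (wdeg a w + D * N e = (p ^ e - 1) * s)%N.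
    rewrite -uD addnC -wdegD /wdeg /s big_distrr; apply: eq_bigr => i _.
    by rewrite uwE.
  move=> /(congr1 (fun n => n%:R : R)); rewrite natrD !natrM natrB // => wE.
  rewrite -(ltr_nat R); have /andP[leN _] := cN e.
  have {}leN : D%:R * (N e)%:R <= D%:R * (c * (p ^ e)%:R) by rewrite ler_wpM2l.
  move: qbig; rewrite natrD; move: wE leN; lra.
have [i le_q'w] : exists i, (q' <= w i)%N.
  apply/existsP; apply: contraTT wD; rewrite negb_exists -leqNgt => /forallP h.
  apply: leq_trans (leq_addl _ _); rewrite /wdeg /s big_distrr leq_sum // => i _.
  by rewrite leq_mul2r ltnW ?orbT // ltnNge.
pose g := f + 'X_[w].
have gm : g \in mmax k d.
  rewrite mmaxE mcoeffD mcoeffX.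
  have /negbTE -> : w != 0%MM by apply: contraTneq le_q'w => ->; rewrite mnm0E -ltnNge q_gt0.
  by rewrite addr0 -mmaxE.
have c_lt_g : c < fpt R (locA_pchar d chk) (loc_of (mmax k d) g).
  have q1_gt0 : (0 < p ^ e - 1)%N by rewrite subn_gt0 -(expn0 p) ltn_exp2l.
  apply: lt_le_trans (_ : (N e).+1%:R / (p ^ e - 1)%:R <= _); last first.
    apply: (mcoeff_small_fpt_ge R Fk gm e_gt0 (u := (u + w)%MM)) => [j|].
      by rewrite uwE ltn_subrL q_gt0.
    rewrite (mcoeff_perturbed_top fD fu); last first.
      by rewrite gtn_eqF // (leq_ltn_trans _ wD) // leq_addr.
    by rewrite -mulr_natr mulf_neq0 // -(dvdn_pcharf chk).
  rewrite ltr_pdivlMr ?ltr0n //; have /andP[_] := cN e; apply: le_lt_trans.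
  by rewrite ler_wpM2l // ler_nat leq_subr.
exists (fpt R (locA_pchar d chk) (loc_of (mmax k d) g)).
  exists (loc_of (mmax k d) g); split=> [gT|]; last exact: erefl.
  have [b] : principal_ideal (loc_of (mmax k d) g : locA k d) 1 by rewrite gT.
  by move/esym; apply: loc_of_mmax_nonunit.
apply/andP; split; first exact: c_lt_g.
have : fpt R (locA_pchar d chk) (loc_of (mmax k d) g) <= (N e').+1%:R / q'%:R.
  apply: mcoeff_small_fpt_le => // v ltv.
  by rewrite (mcoeff_perturbed_small _ _ le_q'w) // fNS.
move=> /le_lt_trans; apply.
rewrite -natr1 mulrDl mul1r; apply: ler_ltD q'_eps; rewrite ler_pdivrMr ?qR_gt0 //.
by have /andP[] := cN e'.
Qed.
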